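(* Let $\Gamma$ be a finitely generated group with finite generating set $X$ satisfying the following two properties: (i) $\Gamma$ has an element of infinite order; (ii) for all nontrivial $\gamma_1,\gamma_2\in\Gamma$ there exists $\mu_{1,2}\in X$ such that $[\gamma_1,\mu_{1,2}\gamma_2\mu_{1,2}^{-1}]\neq 1$. Then: (a) $\mathrm{G}_{\Gamma,X}(n/2)\le \mathrm{F}_{\Gamma,X}\left(6n(\mathrm{w}_{\Gamma,X}(n))^2\right)$ for every positive integer $n$; (b) $n^{1/3}\preceq \mathrm{F}_{\Gamma,X}(n)$.
   Context: $\|\cdot\|_X$ denotes word length with respect to $X$, and for real $t\ge0$, $B_{\Gamma,X}(t)=\{\gamma\in\Gamma:\|\gamma\|_X\le t\}$. $\mathrm{w}_{\Gamma,X}(n)=|B_{\Gamma,X}(n)|$. $\mathrm{F}_{\Gamma,X}(n)$ is the smallest positive integer $N$ such that for every nontrivial $\gamma\in\Gamma$ with $\|\gamma\|_X\le n$ there is a normal subgroup of $\Gamma$ of finite index at most $N$ not containing $\gamma$ (and $\mathrm{F}_{\Gamma,X}(n)=\infty$ if there is no such integer). $\mathrm{G}_{\Gamma,X}(t)$ is the cardinality of the smallest finite group $Q$ for which there exists a surjective homomorphism $\varphi:\Gamma\to Q$ whose restriction to $B_{\Gamma,X}(t)$ is injective ($\infty$ if there is no such finite group). $[a,b]$ denotes the commutator of $a$ and $b$. For functions $f_1,f_2$ on the positive integers with values in $[0,\infty]$, $f_1\preceq f_2$ means that there is a constant $C$ (a positive integer) such that $f_1(n)\le C f_2(Cn)$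 for all $n\geq 1$. *)

(* Defs.v *)
From mathcomp Require Export all_boot all_order all_algebra all_fingroup finmap.
From mathcomp Require Export all_classical all_reals all_analysis.

Set Implicit Arguments.
Unset Strict Implicit.
Unset Printing Implicit Defensive.

Import Order.TTheory GRing.Theory Num.Theory.

Local Open Scope classical_set_scope.
Local Open Scope group_scope.

(* The least element of P, or +oo when P is empty. *)
Definition least (R : realType) (P : set nat) : \bar R :=
  if pselect (exists n, `[< P n >]) is left h
  then ((ex_minn h)%:R%R)%:E else +oo%E.

Section Growth.
Variables (R : realType) (G : groupType).
Implicit Types (X : {fset G}) (g : G) (H : set G).

Definition is_word X (s : seq G) : bool :=
  all [pred x | (x \in X) || (x^-1 \in X)] s.

Definition generates X : Prop :=
  forall g, exists2 s, is_word X s & g = \prod_(x <- s) x.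

Definition word_length X g : \bar R :=
  least R [set n | exists s,
    [/\ size s = n, is_word X s & g = \prod_(x <- s) x]].

Definition wball X (t : R) : set G :=
  [set g | (word_length X g <= t%:E)%E].

(* fset_set is the junk value fset0 on infinite sets; balls are always finite
   because X is, see finite_wball below. *)
Definition word_growth X (n : nat) : nat := #|` fset_set (wball X n%:R%R)|.

Definition normal_subgroup H : Prop :=
  group_closed (mem H) /\ forall h g, H h -> H (h ^ g).

Definition left_cosets H : set (set G) :=
  [set [set g * h | h in H] | g in [set: G]].

Definition index_at_most H (N : nat) : Prop := (left_cosets H #<= `I_N)%card.

Definition rf_growth X (n : nat) : \bar R :=
  least R [set N | (0 < N)%N /\
    forall g, g <> 1 -> (word_length X g <= (n%:R)%:E)%E ->
      exists H, [/\ normal_subgroup H, index_at_most H N & ~ H g]].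

Definition full_rf_growth X (t : R) : \bar R :=
  least R [set k | exists (Q : finGroupType) (phi : {multiplicative G -> Q}),
    [/\ #|Q| = k, set_surj setT setT phi & set_inj (wball X t) phi]].

End Growth.

Arguments word_length R {G} X g.
Arguments word_growth R {G} X n.
Arguments rf_growth R {G} X n.

Definition preceq (R : realType) (f1 f2 : nat -> \bar R) : Prop :=
  exists2 C : nat, (0 < C)%N &
    forall n, (0 < n)%N -> (f1 n <= (C%:R)%:E * f2 (C * n)%N)%E.

Lemma least_le (R : realType) (P : set nat) (t : R) :
  (least R P <= t%:E)%E -> exists2 n, P n & (n%:R <= t)%R.
Proof.
rewrite /least; case: pselect => [h|_]; last by rewrite leye_eq.
by case: ex_minnP => m /asboolP Pm _; rewrite lee_fin => mt; exists m.
Qed.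

Lemma finite_wball (R : realType) (G : groupType) (X : {fset G}) (t : R) :
  finite_set (wball X t).
Proof.
pose A := enum_fset X ++ [seq x^-1 | x <- enum_fset X].
pose B := fix B n := if n is m.+1
  then B m ++ [seq x * y | x <- A, y <- B m] else [:: 1 : G].
have BS n m : (n <= m)%N -> {subset B n <= B m}.
  move=> /subnK <-; elim: (m - n)%N => //= k IH x /IH.
  by rewrite mem_cat => ->.
have inB s : is_word X s -> \prod_(x <- s) x \in B (size s).
  elim: s => [|x s IH] /=; first by rewrite big_nil inE.
  move=> /andP[xX /IH sX]; rewrite big_cons mem_cat; apply/orP; right.
  apply: allpairs_f => //; rewrite mem_cat; case/orP: xX => [->//|xV].
  by apply/orP; right; rewrite -(invgK x) map_f.
have [N tN] : exists N, forall n, (n%:R <= t)%R -> (n <= N)%N.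
  exists (Num.truncn `|t|%R) => n nt; rewrite truncn_ge_nat ?normr_ge0//.
  exact: le_trans nt (ler_norm t).
apply: (@sub_finite_set _ _ [set` B N]); last exact: finite_seq.
move=> g /least_le[n [s [sn sX ->]] /tN nN] /=.
by apply: (BS _ _ nN); rewrite -sn; exact: inB.
Qed.

(* Main.v *)
(* Two nontrivial elements g1, g2 have a nontrivial common multiple
   [g1, mu g2 mu^-1], i.e. an element of every normal subgroup that contains
   g1 or g2. Doing this along a balanced binary tree, m nontrivial elements of
   length at most n have a nontrivial common multiple of length O(n m^2). A
   normal subgroup avoiding it avoids all the m elements. For the elements of
   the ball of radius n this makes the quotient map injective on the ball of
   radius n/2; for the powers g, ..., g^m of an element g of infinite order it
   makes 1, g, ..., g^m distinct in the quotient, whose order then exceeds m,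
   while the common multiple has length O(m^3). *)
From HB Require Import structures.
Require Import Defs.
From mathcomp Require Import zify lra.

Set Implicit Arguments.
Unset Strict Implicit.
Unset Printing Implicit Defensive.

Import Order.TTheory GRing.Theory Num.Theory.

Local Open Scope classical_set_scope.
Local Open Scope group_scope.

Lemma ge_least (R : realType) (P : set nat) n :
  P n -> (least R P <= (n%:R)%:E)%E.
Proof.
move=> Pn; rewrite /least; case: pselect => [h|[]]; last first.
  by exists n; apply/asboolP.
by case: ex_minnP => m _ /(_ n) mn; rewrite lee_fin ler_nat mn//; apply/asboolP.
Qed.

Lemma le_least (R : realType) (P : set nat) (x : \bar R) :
  (forall n, P n -> (x <= (n%:R)%:E)%E) -> (x <= least R P)%E.
Proof.
move=> xP; rewrite /least; case: pselect => [h|_]; last exact: leey.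
by case: ex_minnP => m /asboolP /xP.
Qed.

(** * Normal subgroups and their finite quotients *)

Section NormalSubgroup.
Variables (G : groupType) (H : set G).
Hypothesis nH : normal_subgroup H.

Lemma normal_subgroup1 : H 1.
Proof. by case: nH => -[/[!inE]]. Qed.

Lemma normal_subgroupV g : H g -> H g^-1.
Proof.
case: nH => -[H1 Hd] _ Hg; have := Hd 1 g H1; rewrite !inE mul1g; exact.
Qed.

Lemma normal_subgroupM g h : H g -> H h -> H (g * h).
Proof.
case: nH => -[H1 Hd] _ Hg /normal_subgroupV Hh.
by have := Hd g h^-1; rewrite !inE invgK; apply.
Qed.

Lemma normal_subgroup_conj g h : H g -> H (h * g * h^-1).
Proof.
by case: nH => _ Hc /(Hc _ h^-1); rewrite conjgE invgK mulgA.
Qed.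

(** Either entry can be split off: the commutator is [g^-1 * g ^ h] and also [(h^-1) ^ g * h]. *)
Lemma normal_subgroup_commg g h : H g \/ H h -> H [~ g, h].
Proof.
case: nH => _ Hc [] Hg.
  by rewrite commgEl; apply: normal_subgroupM;
    [exact: normal_subgroupV|exact: Hc].
by rewrite commgEr; apply: normal_subgroupM => //; apply: Hc;
  exact: normal_subgroupV.
Qed.

Lemma eq_left_coset x y :
  [set x * h | h in H] = [set y * h | h in H] <-> H (x^-1 * y).
Proof.
split=> [|Hxy].
  move/seteqP => [_ /(_ y)[]].
    by exists 1; rewrite ?mulg1//; exact: normal_subgroup1.
  by move=> h Hh <-; rewrite mulKg.
apply/seteqP; split=> _ [h Hh <-].
  exists ((x^-1 * y)^-1 * h); last by rewrite invgM invgK -mulgA mulVKg.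
  by apply: normal_subgroupM => //; exact: normal_subgroupV.
exists (x^-1 * y * h); first exact: normal_subgroupM.
by rewrite -mulgA mulVKg.
Qed.

(** The left cosets inject into ['I_N]; the image of this injection carries [Q], which makes it a
    finite type of at most [N] elements. The group law is transported along chosen
    representatives. *)
Lemma finite_quotient N : index_at_most H N ->
  exists (Q : finGroupType) (phi : {multiplicative G -> Q}),
    [/\ #|Q| <= N, set_surj setT setT phi &
        forall x y, phi x = phi y <-> H (x^-1 * y)].
Proof.
pose C (x : G) := [set x * h | h in H].
move=> /pcard_leP[f].
have Cin x : left_cosets H (C x) by exists x.
have fN x : (f (C x) < N)%N by apply: (@funS _ _ _ _ f); exact: Cin.
pose inT (i : 'I_N) := `[< exists x, f (C x) = i >].
pose T : finType := {i | inT i}.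
have cP x : inT (Ordinal (fN x)) by apply/asboolP; exists x.
pose c x : T := exist (fun i => inT i) _ (cP x).
have cE x y : c x = c y <-> H (x^-1 * y).
  rewrite -eq_left_coset; split.
    move=> /(congr1 (fun t : T => val (val t)))/= fxy.
    by apply: (@inj _ _ _ f) fxy; rewrite inE; exact: Cin.
  by move=> Cxy; do 2!apply: val_inj => /=; congr (f _).
have /choice[r rK] : forall i : T, exists x, c x = i.
  by move=> [i iP]; have /asboolP[x xi] := iP; exists x; do 2!apply: val_inj.
have cM x x' y y' : c x = c x' -> c y = c y' -> c (x * y) = c (x' * y').
  rewrite !cE => Hx Hy.
  (* Normality enters here: the discrepancy of [x] and [x'] is conjugated by [y]. *)
  have -> : (x * y)^-1 * (x' * y') =
      ((x^-1 * x') ^ y) * (y^-1 * y').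
    by rewrite invgM conjgE -!mulgA mulVKg.
  by apply: normal_subgroupM => //; apply: (proj2 nH).
pose mulT i j := c (r i * r j).
have cD x y : c (x * y) = mulT (c x) (c y) by apply: cM; rewrite rK.
have mulA : associative mulT.
  by move=> i j k; rewrite -[i]rK -[j]rK -[k]rK -!cD mulgA.
have mul1 : left_id (c 1) mulT by move=> i; rewrite -[i]rK -!cD mul1g.
have mulV : left_inverse (c 1) (fun i => c (r i)^-1) mulT.
  by move=> i; rewrite -{2}[i]rK -!cD mulVg.
pose Q : finGroupType := HB.pack T (Finite_isGroup.Build T mulA mul1 mulV).
pose phi : {multiplicative G -> Q} :=
  HB.pack (c : G -> Q) (isMultiplicative.Build G Q c cD).
exists Q, phi; split=> //.
- by rewrite -[leqRHS]card_ord card_sig max_card.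
- by move=> i _; exists (r i) => //=; exact: rK.
Qed.

End NormalSubgroup.

(** * Length bounds by natural numbers *)

Definition length_le (G : groupType) (X : {fset G}) (n : nat) (g : G) : Prop :=
  exists s, [/\ (size s <= n)%N, is_word X s & g = \prod_(x <- s) x].

Section LengthLe.
Variables (G : groupType) (X : {fset G}).

(** Trades the extended real length for the existence of a short word, so that later bounds are
    integer arithmetic. *)
Lemma word_length_le (R : realType) n g :
  (word_length R X g <= (n%:R)%:E)%E <-> length_le X n g.
Proof.
split=> [/least_le[k [s [sk sX ->]]]|[s [sn sX ->]]].
  by rewrite ler_nat => kn; exists s; rewrite sk.
apply: (@le_trans _ _ ((size s)%:R)%:E); last by rewrite lee_fin ler_nat.
by apply: ge_least; exists s.
Qed.

Lemma length_leW m n g : (m <= n)%N -> length_le X m g -> length_le X n g.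
Proof. by move=> mn [s [sm ? ?]]; exists s; split=> //; lia. Qed.

Lemma length_le1 n : length_le X n 1.
Proof. by exists [::]; rewrite big_nil. Qed.

Lemma length_le_gen g : g \in X -> length_le X 1 g.
Proof. by move=> gX; exists [:: g]; rewrite big_seq1 /= gX. Qed.

Lemma length_leM m n g h :
  length_le X m g -> length_le X n h -> length_le X (m + n) (g * h).
Proof.
move=> [s [sm sX ->]] [t [tn tX ->]]; exists (s ++ t).
by rewrite size_cat leq_add// /is_word all_cat big_cat; split=> //; apply/andP.
Qed.

Lemma length_leV n g : length_le X n g -> length_le X n g^-1.
Proof.
move=> [s [sn sX ->]]; apply: length_leW sn _.
elim: s sX => [_|x s IH] /=; first by rewrite big_nil invg1; exact: length_le1.
move=> /andP[xX sX]; rewrite big_cons invgM -addn1.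
apply: length_leM; first exact: IH.
by exists [:: x^-1]; rewrite big_seq1 /= invgK andbT orbC.
Qed.

Lemma length_le_commg m n g h :
  length_le X m g -> length_le X n h -> length_le X (2 * m + 2 * n) [~ g, h].
Proof.
move=> gm hn; rewrite commgEl conjgE.
have -> : (2 * m + 2 * n = m + (n + (m + n)))%N by lia.
by do 3 ![exact: length_leV|exact: length_leM|apply: length_leM].
Qed.

Lemma length_le_conj n g mu :
  mu \in X -> length_le X n g -> length_le X n.+2 (mu * g * mu^-1).
Proof.
move=> /length_le_gen muX gn; have -> : n.+2 = (1 + n + 1)%N by lia.
by do 2![exact: length_leV|apply: length_leM].
Qed.

Lemma length_leX n g k : length_le X n g -> length_le X (k * n) (g ^+ k).
Proof.
move=> gn; elim: k => [|k IH]; first exact: length_le1.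
by rewrite expgS mulSn; exact: length_leM.
Qed.

End LengthLe.

(* The bound on k is k + 4/3 <= (n + 4/3) (3 m^2 - 1) / 2 with m = size s: the
   commutator of elements of lengths k1 and k2 has length at most
   2 k1 + 2 k2 + 4, so k + 4/3 is additive up to a factor 2, and the summand
   -1/2 absorbs the imbalance of the two halves of s when m is odd. *)
Lemma common_multiple (G : groupType) (X : {fset G})
  (h_comm : forall g1 g2 : G, g1 <> 1 -> g2 <> 1 ->
     exists2 mu : G, mu \in X & [~ g1, mu * g2 * mu^-1] <> 1)
  (n : nat) (s : seq G) : s <> [::] ->
  (forall g, g \in s -> g <> 1 /\ length_le X n g) ->
  exists k g, [/\ (6 * k + 8 + (3 * n + 4) <= (3 * n + 4) * (3 * size s ^ 2))%N,
    length_le X k g, g <> 1 &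
    forall H, normal_subgroup H -> forall x, x \in s -> H x -> H g].
Proof.
have [m] := ubnP (size s); elim: m s => // m IH s; rewrite ltnS => sm s0 sP.
have [s1|s1] := leqP (size s) 1.
  (* A single element is its own multiple, and the bound is an equality for [k = n]. *)
  case: s s0 sP {sm} s1 => [//|g [|//]] _ sP _.
  exists n, g; have [|g1 gn] := sP g; first by rewrite inE.
  split=> //; first by rewrite /=; lia.
  by move=> H _ x /[!inE] /eqP ->.
pose a := (size s)./2; pose b := uphalf (size s).
have ab : (a + b = size s)%N by rewrite /a /b uphalfE; lia.
have a0 : (0 < a)%N by rewrite /a; lia.
have Sa : size (take a s) = a by rewrite size_takel; lia.
have Sb : size (drop a s) = b by rewrite size_drop; lia.
have [||x /mem_take /sP//|k1 [g1 [k1P g1k g1N g1H]]] := IH (take a s).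
  - by rewrite Sa /a; lia.
  - by move=> /(congr1 size); rewrite Sa; apply/eqP; rewrite -lt0n.
have [||x /mem_drop /sP//|k2 [g2 [k2P g2k g2N g2H]]] := IH (drop a s).
  - by rewrite Sb /b; lia.
  - by move=> /(congr1 size); rewrite Sb /b /=; lia.
have [mu muX gN] := h_comm g1 g2 g1N g2N.
exists (2 * k1 + 2 * k2.+2)%N, [~ g1, mu * g2 * mu^-1]; split=> //.
- rewrite Sa in k1P; rewrite Sb in k2P.
  (* The two sides of [2(a^2 + b^2) = (a + b)^2 + (b - a)^2] are compared using that the halves
     differ by at most 1. *)
  have : (2 * (a ^ 2 + b ^ 2) <= size s ^ 2 + 1)%N.
    have : (b = a \/ b = a.+1)%N by rewrite /a /b; lia.
    by rewrite -ab; case=> ->; nia.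
  by nia.
- by apply: length_le_commg => //; exact: length_le_conj.
- move=> H nH x; rewrite -[s](cat_take_drop a) mem_cat => xs Hx.
  apply: normal_subgroup_commg => //; case/orP: xs => xs.
    by left; exact: g1H Hx.
  by right; apply: normal_subgroup_conj => //; exact: g2H Hx.
Qed.

Theorem theorem4p4 (R : realType) (Gam : groupType) (X : {fset Gam})
  (hX : generates X)
  (h_inf : exists g : Gam, forall k : nat, (0 < k)%N -> g ^+ k <> 1)
  (h_comm : forall g1 g2 : Gam, g1 <> 1 -> g2 <> 1 ->
     exists2 mu : Gam, mu \in X & [~ g1, mu * g2 * mu^-1] <> 1) :
  (forall n : nat, (0 < n)%N ->
     (full_rf_growth X (n%:R / 2 : R)%R
        <= rf_growth R X (6 * n * (word_growth R X n) ^ 2)%N)%E)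
  /\ preceq (fun n : nat => (n%:R `^ (3^-1))%:E%R) (rf_growth R X).
Proof.
split=> [n n0|].
  apply: le_least => N [N0 NP].
  have [H [nH HN HB]] : exists H, [/\ normal_subgroup H, index_at_most H N &
      forall g, length_le X n g -> H g -> g = 1].
    pose s := [seq g <- fset_set (wball X (n%:R : R)%R) | g != 1].
    have sP g : (g \in s) = (g != 1) && `[< length_le X n g >].
      rewrite mem_filter in_fset_set; last exact: finite_wball.
      congr (_ && _); apply/idP/asboolP; rewrite inE.
        by move=> /word_length_le.
      by move=> /(word_length_le X R).
    have sw : (size s <= word_growth R X n)%N.
      by rewrite size_filter count_size.
    (* If the ball is trivial there is nothing to avoid, and the whole group, of index 1, serves. *)
    have [s0|s0] := eqVneq s [::].
      exists setT; split=> //.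
      - by split=> //; split=> [|x y _ _]; rewrite inE.
      - apply: (@card_le_trans _ _ _ [set setT]).
          apply: subset_card_le => _ [g _ <-]; apply/seteqP; split=> // h _.
          by exists (g^-1 * h); rewrite ?mulVKg.
        by rewrite (card_le_eql card_set1) card_le_II.
      - move=> g gn _; apply/eqP; apply: contraT => g1.
        have : g \in s by rewrite sP g1; apply/asboolP.
        by rewrite s0.
    have [||k [g [kP gk g1 gH]]] := common_multiple h_comm (n := n) (s := s).
    - exact/eqP.
    - by move=> g; rewrite sP => /andP[/eqP ? /asboolP].
    have [|H [nH HN Hg]] := NP g g1.
      apply/word_length_le; apply: length_leW gk.
      have : (size s ^ 2 <= word_growth R X n ^ 2)%N by rewrite leq_sqr.
      (* With [w] the size of the ball this gives [6k <= 21 n w^2], well within the allowed length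
         [6 n w^2]. *)
      have n7 : (3 * n + 4 <= 7 * n)%N by lia.
      move=> /(leq_mul (leqnn 3)) /(leq_mul n7) /(leq_trans kP).
      by move: (word_growth R X n ^ 2)%N => w2; nia.
    exists H; split=> // x xn Hx; apply/eqP; apply: contraT => x1.
    case: Hg; apply: (gH _ nH x) => //; rewrite sP x1; exact/asboolP.
  have [Q [phi [QN phiS phiE]]] := finite_quotient nH HN.
  apply: (@le_trans _ _ (#|Q|%:R)%:E); last by rewrite lee_fin ler_nat.
  apply: ge_least; exists Q, phi; split=> // x y /[!inE] xn yn /phiE Hxy.
  (* The lengths are integers at most [n/2], so their sum is at most [n] for odd [n] too, and
     [x^-1 * y] lies in the ball that meets [H] only in 1. *)
  have [p [xp pn]] : exists p, length_le X p x /\ (p%:R <= n%:R / 2 :> R)%R.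
    case/least_le: xn => p [s [<- ? ?]] ?.
    by exists (size s); split=> //; exists s.
  have [q [yq qn]] : exists q, length_le X q y /\ (q%:R <= n%:R / 2 :> R)%R.
    case/least_le: yn => q [s [<- ? ?]] ?.
    by exists (size s); split=> //; exists s.
  have /HB/(_ Hxy) xy : length_le X n (x^-1 * y).
    apply: (@length_leW _ _ (p + q)).
      by rewrite -(ler_nat R) natrD; lra.
    by apply: length_leM => //; exact: length_leV.
  by rewrite -[LHS]mulg1 -xy mulVKg.
have [g gP] := h_inf.
have [l gl] : exists l, length_le X l g.
  by have [s sX ->] := hX g; exists (size s), s.
(* The powers of [g] used below have length at most [m * l] with [m ^ 3 <= n], so
   [6k <= (3ml + 4) 3m^2 <= (9l + 12) n]. *)
exists (4 * l.+1)%N => // n n0.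
set x : R := (n%:R `^ 3^-1)%R.
have x0 : (0 <= x)%R by exact: powR_ge0.
have x3 : (x ^+ 3 = n%:R)%R.
  by rewrite /x -powR_mulrn ?powR_ge0// -powRrM mulVf ?powRr1.
set m := Num.truncn x.
have mx : (m%:R <= x)%R by rewrite /m truncn_le.
have xm : (x < m.+1%:R)%R by rewrite /m truncnS_gt.
have mn : (m ^ 3 <= n)%N.
  by rewrite -(ler_nat R) natrX -x3 lerXn2r ?nnegrE.
have m0 : (0 < m)%N.
  by rewrite truncn_gt0 -(@ler_pXn2r _ 3)// ?nnegrE// x3 expr1n ler1n.
pose s := [seq g ^+ i | i <- iota 1 m].
have [||k [h [kP hk h1 hH]]] := common_multiple h_comm (n := m * l) (s := s).
- by move=> /(congr1 size); rewrite size_map size_iota /=; lia.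
- move=> _ /mapP[i /[!mem_iota] /andP[i1 im] ->]; split; first exact: gP.
  apply: (@length_leW _ _ (i * l)); last exact: length_leX.
  by rewrite leq_mul2r; lia.
have F_ge : (x%:E <= rf_growth R X (4 * l.+1 * n))%E.
  apply: le_least => N [N0 /(_ _ h1)[|H [nH HN Hh]]].
    apply/word_length_le; apply: length_leW hk.
    by rewrite size_map size_iota in kP; nia.
  (* Rounding [x] down to [m] costs nothing: [1, g, ..., g^m] are [m.+1] elements, and
     [x < m.+1]. *)
  rewrite lee_fin (le_trans (ltW xm))// ler_nat.
  have [Q [phi [QN _ phiE]]] := finite_quotient nH HN.
  apply: leq_trans QN; rewrite -[leqLHS]card_ord.
  apply: (@leq_card _ _ (fun i : 'I_m.+1 => phi (g ^+ i))).
  (* A coincidence would put [g ^+ (j - i)], a member of [s], into [H], and with it the common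
     multiple [h]. *)
  have inj (i j : nat) : (i < j < m.+1)%N -> phi (g ^+ i) <> phi (g ^+ j).
    move=> /andP[ij jm] /phiE Hij; apply: Hh; apply: (hH _ nH (g ^+ (j - i))).
      by apply: map_f; rewrite mem_iota; lia.
    suff -> : g ^+ (j - i) = (g ^+ i)^-1 * g ^+ j by [].
    by rewrite -[in RHS](subnKC (ltnW ij)) expgnDr mulKg.
  move=> i j ij; apply: val_inj => /=; have [ji|ji|//] := ltngtP i j.
    by case: (@inj i j _ ij); rewrite ji ltn_ord.
  by case: (@inj j i _ (esym ij)); rewrite ji ltn_ord.
apply: (le_trans F_ge); apply: lee_pemull.
  by apply: le_trans F_ge; rewrite lee_fin.
by rewrite lee_fin ler1n.
Qed.
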